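(* Let $X$ be a reflexive Banach space with $1$-symmetric basis. Then the Haar system $(h_n)_{n\ge1}$ is a Schauder basis for $JF_X$.
   Context: $X$ is a (infinite-dimensional, real) reflexive Banach space with a $1$-symmetric basis $(e_n)_n$, i.e. $\|\sum_n \epsilon_n a_n e_{\pi(n)}\|_X=\|\sum_n a_n e_n\|_X$ for all finitely supported real $(a_n)$, signs $\epsilon_n$ and permutations $\pi$ of $\mathbb{N}$. $JF_X$ is the completion of $L^1((0,1))$ under the norm $\|f\|_{JF_X}=\sup\{\|\sum_{j=1}^m(\int_{I_j}f\,d\mu)e_j\|_X : I_1,\dots,I_m\subset(0,1)\text{ pairwise disjoint open intervals}\}$, where $\mu$ is Lebesgue measure. The Haar system is $h_1=\chi_{[0,1]}$ and $h_{2^k+i}=\chi_{[\frac{2i-2}{2^{k+1}},\frac{2i-1}{2^{k+1}}]}-\chi_{(\frac{2i-1}{2^{k+1}},\frac{2i}{2^{k+1}}]}$ for $1\le i\le2^k$, $k=0,1,2,\dots$. *)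

(* Defs.v *)
From HB Require Import structures.
From mathcomp Require Import all_boot all_order all_algebra.
From mathcomp Require Import all_classical all_reals all_analysis.

Set Implicit Arguments.
Unset Strict Implicit.
Unset Printing Implicit Defensive.

Import Order.TTheory GRing.Theory Num.Theory.
Import numFieldNormedType.Exports.

Local Open Scope classical_set_scope.
Local Open Scope ring_scope.

Definition schauder_basis (R : realType) (X : normedModType R)
    (e : nat -> X) : Prop :=
  forall x : X, exists! a : nat -> R,
    series (fun k => a k *: e k) @ \oo --> x.

Definition one_symmetric_basis (R : realType) (X : normedModType R)
    (e : nat -> X) : Prop :=
  schauder_basis e /\
  forall (n : nat) (a : nat -> R) (eps : nat -> bool) (pi : nat -> nat),
    bijective pi ->
    `|\sum_(k < n) ((-1) ^+ eps k * a k) *: e (pi k)| =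
    `|\sum_(k < n) a k *: e k|.

Section Reflexivity.
Context (R : realType) (X : normedModType R).

Definition dual : set (X -> R) :=
  [set f | linear (f : X -> R^o) /\ continuous f].

Definition dual_norm (f : X -> R) : R :=
  sup [set `|f x| | x in [set x : X | `|x| <= 1]].

(* Elements of the bidual are encoded as maps on all functions X -> R, of
   which only the values on [dual] matter. *)
Definition bidual : set ((X -> R) -> R) :=
  [set Phi | (forall (c : R) (f g : X -> R), dual f -> dual g ->
                Phi (fun x => c * f x + g x) = c * Phi f + Phi g) /\
             exists M : R, forall f, dual f -> `|Phi f| <= M * dual_norm f].

(* surjectivity of the canonical embedding of X into its bidual *)
Definition reflexive_space : Prop :=
  forall Phi, bidual Phi -> exists x : X, forall f, dual f -> Phi f = f x.

End Reflexivity.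

(* Linear isometries onto a dense subspace of a Banach space.  [N] need only be
   a seminorm: [iota] then factors through the quotient of [V] by its kernel. *)
Definition is_completion (R : realType) (V : lmodType R) (N : V -> R)
    (Y : completeNormedModType R) (iota : {linear V -> Y}) : Prop :=
  (forall v, `|iota v| = N v) /\ dense (range iota).

Section L1.
Context (R : realType).

Let lebesgue_measure01_lty : (lebesgue_measure (`]0%R, 1%R[ : set R) < +oo)%E.
Proof. by rewrite lebesgue_measure_itv/= lte_fin ltr01 oppr0 adde0 ltry. Qed.

Definition lebesgue01 : {finite_measure set (measurableTypeR R) -> \bar R} :=
  @mfrestr _ (measurableTypeR R) R _ lebesgue_measure
    (measurable_itv `]0%R, 1%R[) lebesgue_measure01_lty.

(* Functions, not classes of functions: those equal almost everywhere on ]0, 1[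
   are identified only when passing to the completion. *)
Definition L1 := LfunType lebesgue01 (lexx 1%E).

End L1.

Definition JF_norm (R : realType) (X : normedModType R) (e : nat -> X)
    (f : L1 R) : R :=
  sup [set y | exists (m : nat) (a b : 'I_m -> R),
    [/\ forall j, 0 <= a j /\ a j < b j /\ b j <= 1,
        trivIset [set: 'I_m] (fun j => `]a j, b j[%classic) &
        y = `|\sum_(j < m)
               (\int[lebesgue_measure]_(x in `]a j, b j[) f x) *: e j|]].

Section Haar.
Context (R : realType).

Definition dyadic (k j : nat) : R := j%:R / 2 ^+ k.

Definition haar_wavelet (k i : nat) : measurableTypeR R -> R :=
  fun x => \1_(`[dyadic k.+1 (2 * i - 2), dyadic k.+1 (2 * i - 1)]) x
         - \1_(`]dyadic k.+1 (2 * i - 1), dyadic k.+1 (2 * i)]) x.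

(* Numbered from 0: [haar_fun n] is h_(n+1). *)
Definition haar_fun (n : nat) : measurableTypeR R -> R :=
  if n is 0 then \1_(`[0, 1])
  else let k := trunc_log 2 n in haar_wavelet k (n.+1 - 2 ^ k).

Lemma haar_funE (k i : nat) : (0 < i <= 2 ^ k)%N ->
  haar_fun (2 ^ k + i).-1 = haar_wavelet k i.
Proof.
case: i => // i /andP[_ ik]; rewrite addnS /haar_fun/=.
have -> : trunc_log 2 (2 ^ k + i) = k.
  by apply: trunc_log_eq => //; rewrite leq_addr/= expnS mul2n -addnn ltn_add2l.
case E : (2 ^ k + i)%N => [|m].
  by have := expn_gt0 2 k; rewrite -(ltn_add2r i) E.
by rewrite -E -addnS addKn.
Qed.

Let haar_fun_integrable n :
  (lebesgue01 R).-integrable setT (EFin \o haar_fun n).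
Proof.
have int1 (A : set (measurableTypeR R)) : measurable A ->
    (lebesgue01 R).-integrable setT (EFin \o \1_A).
  exact: integrable_indic.
case: n => [|n]; first exact: int1.
rewrite /haar_fun /haar_wavelet.
have int_itv (i : interval R) := int1 [set` i] (measurable_itv i).
by have := integrableB measurableT (int_itv _) (int_itv _); exact.
Qed.

Lemma haar_fun_L1 n : haar_fun n \in Lfun (lebesgue01 R) 1%E.
Proof. exact/Lfun1_integrable/haar_fun_integrable. Qed.

Definition haar (n : nat) : L1 R := Lfun_Sub (lexx 1%E) (haar_fun_L1 n).

End Haar.

(* Main.v *)
(* Write F for the primitive of f, so that the norm of f is the supremum of
   |sum_j (F b_j - F a_j) e_j| over disjoint intervals ]a_j, b_j[.  The Haar
   basis is monotone for this norm.  Indeed, let f = g + c h_n with g a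
   combination of the earlier Haar functions; g is constant on the support
   [p, q] of h_n, so its primitive G is affine there and agrees with F outside
   ]p, q[ up to a constant.  Rounding every point of ]p, q[ down to p or up to q
   according to a threshold is nondecreasing, hence maps disjoint intervals to
   disjoint (possibly empty) intervals, and G x is the average over the
   thresholds of G at the rounded point.  By convexity the norm of g is at most
   that of f.  Symmetry of the basis of X is used only to drop empty intervals
   and to bound the norms of the e_j.  Totality follows from the density of
   continuous functions in L^1 and the domination of the norm by a multiple of
   the L^1 norm. *)

Require Import Defs.
From mathcomp Require Import all_boot all_order all_algebra.
From mathcomp Require Import all_classical all_reals all_analysis.
From mathcomp Require Import lra ring zify.
Import Order.TTheory GRing.Theory Num.Theory.
Import numFieldNormedType.Exports.
Set Implicit Arguments.
Unset Strict Implicit.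
Unset Printing Implicit Defensive.
Local Open Scope classical_set_scope.
Local Open Scope ring_scope.

(** * Monotone total sequences are Schauder bases *)

Section MonotoneBasis.
Context (R : realType) (Y : completeNormedModType R) (y : nat -> Y).
Hypothesis y_neq0 : forall k, y k != 0.
Hypothesis monotone : forall (a : nat -> R) n,
  `|\sum_(k < n) a k *: y k| <= `|\sum_(k < n.+1) a k *: y k|.
Hypothesis total : forall (x : Y) (r : R), 0 < r ->
  exists (a : nat -> R) n, `|x - \sum_(k < n) a k *: y k| < r.

Let S (a : nat -> R) n := \sum_(k < n) a k *: y k.

Let S_monotone a m n : (m <= n)%N -> `|S a m| <= `|S a n|.
Proof.
elim: n => [|n IHn]; first by rewrite leqn0 => /eqP ->.
rewrite leq_eqVlt => /predU1P[-> //|]; rewrite ltnS => /IHn mn.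
exact: le_trans mn (monotone a n).
Qed.

Let SB a b n : S (fun k => a k - b k) n = S a n - S b n.
Proof. by rewrite /S -sumrB; apply: eq_bigr => k _; rewrite scalerBl. Qed.

(** [a k *: y k] is the difference of two consecutive partial sums, and monotonicity bounds both by
    [S a n]. Hence coefficients depend continuously on the sum. *)
Let coef_le a k n : (k < n)%N -> `|a k| <= 2 / `|y k| * `|S a n|.
Proof.
move=> kn; have yk : 0 < `|y k| by rewrite normr_gt0.
rewrite mulrAC ler_pdivlMr// -normrZ.
have -> : a k *: y k = S a k.+1 - S a k by rewrite /S big_ord_recr/= [RHS]addrC addKr.
apply: (le_trans (ler_normB _ _)).
by rewrite mulr_natl mulr2n lerD// S_monotone// ltnW.
Qed.

Let S_cvg0 a : S a @ \oo --> 0 -> forall k, a k = 0.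
Proof.
move=> Sa0 k; apply/eqP; rewrite -normr_le0; apply/ler_addgt0Pl => r r0.
have y2 : 0 < 2 / `|y k| by rewrite divr_gt0// normr_gt0.
move/cvgrPdist_le : Sa0 => /(_ _ (divr_gt0 r0 y2))[N _].
move=> /(_ (maxn N k.+1) (leq_maxl _ _)).
rewrite sub0r normrN addr0 ler_pdivlMr// mulrC => SN.
exact: le_trans (coef_le a (leq_maxr N k.+1)) SN.
Qed.

(** By [coef_le] the coefficients of approximants [b j] of [x] are Cauchy in [j]. Their limits [a]
    give the expansion, since [S (b j) m] approaches [S a m] at a rate independent of [m].
    Uniqueness is [S_cvg0]. *)
Lemma schauder_basis_monotone : schauder_basis y.
Proof.
have seriesE a : series (fun k => a k *: y k) = S a.
  by apply/funext => n; rewrite /series/= big_mkord.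
move=> x.
have /boolp.choice[b bN] : forall j, exists bj : nat -> R,
    exists N, forall m, (N <= m)%N -> `|x - S bj m| <= j.+1%:R^-1.
  move=> j.
  have [|a [n an]] := @total x j.+1%:R^-1; first by rewrite invr_gt0.
  (* Padding by zeros makes the partial sums constant from [n] on. *)
  exists (fun k => if (k < n)%N then a k else 0), n => m nm.
  rewrite (_ : S _ m = \sum_(k < n) a k *: y k) ?ltW//.
  rewrite (big_ord_widen m (fun k => a k *: y k) nm) big_mkcond/=.
  by apply: eq_bigr => i _; case: ifP => // _; rewrite scale0r.
have bbS j l m : `|S (fun k => b j k - b l k) m| <= j.+1%:R^-1 + l.+1%:R^-1.
  have [[N1 H1] [N2 H2]] := (bN j, bN l).
  (* Monotonicity lets [m] grow to an index where both approximations of [x] hold. *)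
  pose M := maxn m (maxn N1 N2).
  apply: (le_trans (@S_monotone _ m M (leq_maxl _ _))).
  rewrite SB -(subrKA x).
  apply: (le_trans (ler_normD _ _)); rewrite lerD//.
    by rewrite distrC H1// /M; lia.
  by rewrite H2// /M; lia.
have /boolp.choice[a ba] : forall k, exists ak : R, b ^~ k @ \oo --> ak.
  move=> k.
  suff bc : cauchy_ex (b ^~ k @ \oo).
    by exists (limn (b ^~ k)); apply: cauchy_cvg; exact: cauchy_exP.
  move=> r r0.
  have y2 : 0 < 2 / `|y k| by rewrite divr_gt0// normr_gt0.
  (* [2 / |y k|] is the constant of [coef_le]; the final halving serves the two terms of [bbS]. *)
  have d0 : 0 < r / (2 / `|y k|) / 2 by apply: divr_gt0 => //; exact: divr_gt0.
  have := @near_infty_natSinv_lt R (PosNum d0); case=> N _ HN.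
  exists (b N k); exists N => // l /= Nl.
  rewrite -ball_normE/=.
  apply: (le_lt_trans (@coef_le (fun k => b N k - b l k) k k.+1 (ltnSn k))).
  rewrite mulrC -ltr_pdivlMr//; apply: (le_lt_trans (bbS _ _ _)).
  by rewrite [ltRHS]splitr ltrD//; apply: HN => //=.
have Sba m : (fun j => S (b j) m) @ \oo --> S a m.
  by apply: cvg_big => [|k _]; [exact: add_continuous|apply: cvgZr_tmp; exact: ba].
(* This is [bbS] in the limit [l] to infinity. *)
have baS j m : `|S (b j) m - S a m| <= j.+1%:R^-1.
  have cvgd : (fun l => `|S (b j) m - S (b l) m|) @ \oo --> `|S (b j) m - S a m|.
    by apply: cvg_norm; apply: cvgB; [exact: cvg_cst|exact: Sba].
  have cvgj : (fun l => j.+1%:R^-1 + l.+1%:R^-1 : R) @ \oo --> (j.+1%:R^-1 + 0 : R).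
    by apply: cvgD; [exact: cvg_cst|exact: cvg_harmonic].
  rewrite -[leRHS]addr0 -subr_ge0; apply: (cvgr_to_ge (cvgB cvgj cvgd)).
  by apply: nearW => l; rewrite subr_ge0 -SB bbS.
have Sax : S a @ \oo --> x.
  apply/cvgrPdist_lt => r r0.
  have r2 : 0 < r / 2 by rewrite divr_gt0.
  have [N _ /(_ N (leqnn N)) /= HN] := @near_infty_natSinv_lt R (PosNum r2).
  have [M HM] := bN N.
  exists M => // m /= Mm.
  rewrite -(subrKA (S (b N) m)) (splitr r).
  apply: (le_lt_trans (ler_normD _ _)); rewrite ltrD//.
    exact: le_lt_trans (HM _ Mm) HN.
  exact: le_lt_trans (baS _ _) HN.
exists a; split; first by rewrite seriesE.
move=> c; rewrite seriesE => Scx; apply/funext => k; apply/eqP.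
rewrite -subr_eq0; apply/eqP; move: k; apply: S_cvg0.
have -> : S (fun k => a k - c k) = S a - S c by apply/funext => n; rewrite SB.
rewrite -(subrr x); apply: cvgB => //.
Qed.
End MonotoneBasis.

(** * Rounding and averaging *)

Section Averaging.
Context (R : realType).

(** The sum counts the naturals below both [t] and [M]: it is the minimum of [M] and the ceiling of
    [t]. *)
Lemma sum_lt_bounds (t : R) M : 0 <= t ->
  Num.min t M%:R <= \sum_(s < M) (s%:R < t)%R%:R <= Num.min (t + 1) M%:R.
Proof.
move=> t0; elim: M => [|M /andP[IH1 IH2]].
  by rewrite big_ord0 !min_r ?lexx//; lra.
move: IH1 IH2; rewrite !le_min !ge_min big_ord_recr/= -natr1.
move=> /orP IH1 /andP[IH2 IH3]; case: ltP => Mt; last first.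
  by rewrite addr0; case: IH1 => IH1; apply/and3P; split;
    [apply/orP; left; lra|lra|lra|apply/orP; left; lra|lra|lra].
by rewrite mulr1n; case: IH1 => IH1; apply/and3P; split;
  [apply/orP; right| | |apply/orP; right| |]; lra.
Qed.

(** The threshold is [p + r * (q - p)], so [r] is its relative position in [[p, q]]. *)
Definition step_round (p q r x : R) : R :=
  if (x <= p) || (q <= x) then x else if r * (q - p) < x - p then q else p.

Lemma step_round_ndecr (p q r : R) : p <= q -> {homo step_round p q r : x y / x <= y}.
Proof.
move=> pq x y xy; rewrite /step_round.
case: (leP x p) => xp/=; case: (leP q x) => qx/=; case: (leP y p) => yp/=;
 case: (leP q y) => qy/=; do ?[case: ltP => ?]; lra.
Qed.

Lemma step_round_notin (p q r x : R) :
  step_round p q r x <= p \/ q <= step_round p q r x.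
Proof.
rewrite /step_round; case: ifP => [/orP//|_].
by case: ifP => _; [right|left].
Qed.

Lemma step_round_01 (p q r : R) : 0 <= p -> p < q -> q <= 1 ->
  forall x, 0 <= x <= 1 -> 0 <= step_round p q r x <= 1.
Proof.
move=> p0 pq q1 x x01; rewrite /step_round.
by case: ifP => // _; case: ifP => _; apply/andP; split; lra.
Qed.

(** If [x] has relative position [l] in []p, q[], the proportion of equidistant thresholds below [x]
    tends to [l], so the averages tend to [(1 - l) * G p + l * G q], which is [G x] because [G] is
    affine there. Other points are never moved. *)
Lemma cvg_avg_step_round (p q : R) (G : R -> R) x : p < q ->
  (forall z, p <= z <= q -> (q - p) * (G z - G p) = (z - p) * (G q - G p)) ->
  (fun M => M.+1%:R^-1 * \sum_(s < M.+1) G (step_round p q (s%:R / M.+1%:R) x))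
    @ \oo --> G x.
Proof.
move=> pq affG; have qp : 0 < q - p by rewrite subr_gt0.
have [xpq|] := boolP ((x <= p) || (q <= x)).
  have -> : (fun M => M.+1%:R^-1 *
      \sum_(s < M.+1) G (step_round p q (s%:R / M.+1%:R) x)) = fun=> G x.
    apply/funext => M.
    under eq_bigr do rewrite /step_round xpq.
    by rewrite sumr_const card_ord -[G x *+ _]mulr_natl mulKf.
  exact: cvg_cst.
move=> /[dup] /negbTE xpq; rewrite negb_or -!ltNge => /andP[px xq].
pose l := (x - p) / (q - p).
have l0 : 0 <= l by rewrite divr_ge0// subr_ge0 ltW.
have l1 : l <= 1 by rewrite ler_pdivrMr// mul1r lerD2r ltW.
have GE : G x = G p + l * (G q - G p).
  apply/eqP; rewrite addrC -subr_eq; apply/eqP/(mulfI (lt0r_neq0 qp)).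
  by rewrite affG ?ltW// mulrA /l [_ * (_ / _)]mulrC divfK// lt0r_neq0.
(* The proportion of thresholds that send [x] up to [q]. *)
pose c (M : nat) : R := M.+1%:R^-1 * \sum_(s < M.+1) (s%:R < M.+1%:R * l)%R%:R.
have -> : (fun M => M.+1%:R^-1 *
    \sum_(s < M.+1) G (step_round p q (s%:R / M.+1%:R) x)) =
    (fun M => G p + c M * (G q - G p)).
  apply/funext => M; rewrite /c -mulrA mulr_suml.
  rewrite {1}(_ : G p = M.+1%:R^-1 * \sum_(s < M.+1) G p); last first.
    by rewrite sumr_const card_ord -[G p *+ _]mulr_natl mulKf.
  rewrite -mulrDr -big_split/=; congr (_ * _); apply: eq_bigr => s _.
  rewrite /step_round xpq mulrAC ltr_pdivrMr// -ltr_pdivlMr//.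
  rewrite [_ * M.+1%:R / _]mulrAC -/l [l * _]mulrC.
  by case: ifP => _; rewrite ?mulr1n ?mulr0n ?mul1r ?mul0r ?addr0// addrC subrK.
rewrite GE; apply: cvgD; first exact: cvg_cst.
apply: cvgMr_tmp.
have cl M : l <= c M <= l + M.+1%:R^-1.
  have M0 : 0 < M.+1%:R :> R by [].
  have := @sum_lt_bounds (M.+1%:R * l) M.+1 (mulr_ge0 (ltW M0) l0).
  rewrite [X in X <= _]min_l; last by rewrite ler_piMr.
  move=> /andP[c1 c2]; rewrite /c ler_pdivlMl// c1/=.
  by rewrite ler_pdivrMl// mulrDr mulfV// (le_trans c2)// ge_min lexx.
apply: (@squeeze_cvgr _ _ _ _ (fun=> l) (fun M => l + M.+1%:R^-1)).
- by apply: nearW => M; exact: cl.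
- exact: cvg_cst.
- by rewrite -[X in _ --> X]addr0; apply: cvgD; [exact: cvg_cst|exact: cvg_harmonic].
Qed.

End Averaging.

(** * Increments of primitives *)

Section L1Integral.
Context (R : realType).
Implicit Types (f g : L1 R) (a b : R).
Local Notation mu := (@lebesgue_measure R).

(** On measurable subsets of []0, 1[] the measure [lebesgue01] coincides with Lebesgue measure. *)
Lemma integrable_L1 f (D : set (measurableTypeR R)) :
  measurable D -> D `<=` `]0, 1[ -> mu.-integrable D (EFin \o f).
Proof.
move=> mD D01.
have /Lfun1_integrable fi := LfunP f.
have /integrableP[mf fley] := integrableS measurableT mD (@subsetT _ D) fi.
apply/integrableP; split => //.
rewrite (_ : integral _ _ _ = \int[lebesgue01 R]_(x in D) `|(EFin \o f) x|)%E//.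
apply: eq_measure_integral => A mA AD.
by rewrite /lebesgue01/= /mfrestr /mrestr setIidl//; exact: subset_trans AD D01.
Qed.

Lemma subset_itvoo01 a b : 0 <= a -> b <= 1 -> (`]a, b[ `<=` `]0, 1[)%classic.
Proof.
by move=> a0 b1; apply: subset_itvW => //; rewrite bnd_simp.
Qed.

Definition increment f a b : R := \int[mu]_(x in `]a, b[) f x.

Lemma incrementxx f a : increment f a a = 0.
Proof. by rewrite /increment set_itvoo0 Rintegral_set0. Qed.

Lemma incrementD f g a b : 0 <= a -> b <= 1 ->
  increment (f + g) a b = increment f a b + increment g a b.
Proof.
move=> a0 b1; rewrite /increment -RintegralD//;
  by apply: integrable_L1 => //; exact: subset_itvoo01.
Qed.

Lemma incrementZ c f a b : 0 <= a -> b <= 1 ->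
  increment (c *: f) a b = c * increment f a b.
Proof.
move=> a0 b1; rewrite /increment -RintegralZl//.
by apply: integrable_L1 => //; exact: subset_itvoo01.
Qed.

Lemma increment_sum (c : nat -> R) (h : nat -> L1 R) n a b : 0 <= a -> b <= 1 ->
  increment (\sum_(k < n) c k *: h k) a b = \sum_(k < n) c k * increment (h k) a b.
Proof.
move=> a0 b1; elim: n => [|n IH].
  rewrite !big_ord0 -(scale0r (0 : L1 R)) incrementZ// mul0r//.
by rewrite !big_ord_recr/= incrementD// incrementZ// IH.
Qed.

(** The absolute value moves inside each integral, and the integrals over disjoint intervals add up
    to one over a subset of []0, 1[]. *)
Lemma sum_increment_le f m (a b : 'I_m -> R) :
  (forall j, 0 <= a j /\ a j < b j /\ b j <= 1) ->
  trivIset [set: 'I_m] (fun j => `]a j, b j[%classic) ->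
  \sum_(j < m) `|increment f (a j) (b j)| <= \int[mu]_(x in `]0, 1[) `|f x|.
Proof.
move=> ab tI.
have fi j : mu.-integrable `]a j, b j[ (EFin \o f).
  have [? [? ?]] := ab j.
  by apply: integrable_L1 => //; exact: subset_itvoo01.
have fi01 : mu.-integrable `]0, 1[ (EFin \o f) by exact: integrable_L1.
have fi01' : mu.-integrable `]0, 1[ (EFin \o (fun x => `|f x|)) by exact: integrable_norm.
apply: (@le_trans _ _ (\sum_(j < m) \int[mu]_(x in `]a j, b j[) `|f x|)).
  by apply: ler_sum => j _; apply: le_normr_Rintegral.
pose D := \big[setU/set0]_(j <- enum 'I_m) `]a j, b j[%classic.
have mD : measurable D by apply: bigsetU_measurable => j _.
have D01 : D `<=` `]0, 1[%classic.
  rewrite /D; elim/big_ind : _ => [|A B A1 B1|j _]; first exact: sub0set.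
    by rewrite subUset.
  by have [? [? ?]] := ab j; exact: subset_itvoo01.
have fiD : mu.-integrable D (EFin \o (fun x => `|f x|)).
  by apply: integrableS fi01'.
rewrite -lee_fin /Rintegral -sumEFin fineK; last exact: integrable_fin_num.
rewrite (eq_bigr (fun j => \int[mu]_(x in `]a j, b j[) `|f x|%:E)%E); last first.
  move=> j _; rewrite fineK//; apply: integrable_fin_num => //.
  exact: (integrable_norm (fi j)).
rewrite -big_enum/= -ge0_integral_bigsetU ?enum_uniq//=; first last.
- by case/integrableP : fiD.
- by move=> i j _ _; exact: tI.
apply: ge0_subset_integral => //.
by case/integrableP : fi01'.
Qed.
End L1Integral.

(** * The JF norm *)

Section Packing.
Context (R : realType).
Implicit Types (a b : nat -> R).

(** Intervals may be empty, and separation is an inequality between endpoints rather than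
    disjointness: this form survives every nondecreasing map of [[0, 1]] into itself. *)
Definition packing m a b : Prop :=
  (forall j, (j < m)%N -> [/\ 0 <= a j, a j <= b j & b j <= 1]) /\
  (forall i j, (i < m)%N -> (j < m)%N -> i != j -> b i <= a j \/ b j <= a i).

Lemma packing_trivIset m a b : packing m a b ->
  trivIset [set: 'I_m] (fun j => `]a j, b j[%classic).
Proof.
move=> [_ sep]; apply/trivIsetP => i j _ _ ij; apply/seteqP; split => // x/=.
rewrite !in_itv/= => -[/andP[ix xi] /andP[jx xj]].
by have [] := sep i j (ltn_ord i) (ltn_ord j) ij; lra.
Qed.

Lemma trivIset_packing m (a b : 'I_m -> R) :
  (forall j, 0 <= a j /\ a j < b j /\ b j <= 1) ->
  trivIset [set: 'I_m] (fun j => `]a j, b j[%classic) ->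
  let ext (c : 'I_m -> R) k := if insub k is Some i then c i else 0 in
  packing m (ext a) (ext b).
Proof.
move=> ab /trivIsetP tI ext.
have extE c (i : 'I_m) : ext c i = c i by rewrite /ext valK.
split=> [j jm|i j im jm ij].
  rewrite -[j]/(nat_of_ord (Ordinal jm)) !extE.
  by have [? [? ?]] := ab (Ordinal jm); split => //; exact: ltW.
rewrite -[i]/(nat_of_ord (Ordinal im)) -[j]/(nat_of_ord (Ordinal jm)) !extE.
set i' := Ordinal im; set j' := Ordinal jm.
have [?|ji] := leP (b i') (a j'); first by left.
have [?|ij'] := leP (b j') (a i'); first by right.
have [_ [abi _]] := ab i'; have [_ [abj _]] := ab j'.
(* Overlapping intervals share the midpoint of their intersection. *)
pose x := (Num.max (a i') (a j') + Num.min (b i') (b j')) / 2.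
have /seteqP[/(_ x) /= xI _] := tI i' j' I I ij; exfalso; apply: xI.
rewrite !in_itv/= /x maxElt minElt.
by case: (ltP (a i') (a j')) => ?; case: (ltP (b i') (b j')) => ?; split; apply/andP; split; lra.
Qed.

(** A transposition of all of [nat], because [one_symmetric_basis] is stated for bijections of
    [nat]. *)
Definition swapn (i j k : nat) : nat :=
  if k == i then j else if k == j then i else k.

Lemma swapnK i j : involutive (swapn i j).
Proof.
move=> k; rewrite /swapn.
have [->|ki] := eqVneq k i; first by rewrite eqxx; case: eqVneq.
have [->|kj] := eqVneq k j; first by rewrite eqxx.
by rewrite (negbTE ki) (negbTE kj).
Qed.

Lemma swapn_lt i j k m : (i < m)%N -> (j < m)%N -> (k < m)%N -> (swapn i j k < m)%N.
Proof. by rewrite /swapn; case: ifP => // _; case: ifP. Qed.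

Lemma big_swapn (Y : zmodType) (F : nat -> Y) i j m : (i < m)%N -> (j < m)%N ->
  \sum_(k < m) F (swapn i j k) = \sum_(k < m) F k.
Proof.
move=> im jm.
pose s (k : 'I_m) := Ordinal (swapn_lt im jm (ltn_ord k)).
rewrite [RHS](reindex_inj (h := s))//.
by apply: (@can_inj _ _ _ s) => k; apply: val_inj; exact: swapnK.
Qed.

Lemma packing_swapn m a b i j : (i < m)%N -> (j < m)%N ->
  packing m a b -> packing m (a \o swapn i j) (b \o swapn i j).
Proof.
move=> im jm [ab sep]; split=> [k km|k l km lm kl] /=.
  by apply: ab; exact: swapn_lt.
by apply: sep; rewrite ?swapn_lt// (inj_eq (inv_inj (swapnK i j))).
Qed.

Lemma packing_leq m n a b : (m <= n)%N -> packing n a b -> packing m a b.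
Proof.
move=> mn [ab sep]; split=> [j jm|i j im jm]; first exact: ab (leq_trans jm mn).
by apply: sep; exact: leq_trans mn.
Qed.

Lemma packing_homo m a b (S : R -> R) : {homo S : x y / x <= y} ->
  (forall x, 0 <= x <= 1 -> 0 <= S x <= 1) ->
  packing m a b -> packing m (S \o a) (S \o b).
Proof.
move=> hS S01 [ab sep]; split=> [j jm|i j im jm ij] /=.
  have [a0 aj b1] := ab j jm.
  have /andP[? _] := S01 (a j) ltac:(by rewrite a0 (le_trans aj)).
  have /andP[_ ?] := S01 (b j) ltac:(by rewrite b1 (le_trans a0)).
  by split => //; exact: hS.
by case: (sep i j im jm ij) => /hS; [left|right].
Qed.

End Packing.

(** * The norm as a supremum over packings *)

Section JF.
Context (R : realType) (X : normedModType R) (e : nat -> X).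
Hypothesis e_symmetric : one_symmetric_basis e.
Implicit Types (f : L1 R) (a b c : nat -> R).

Lemma norm_sum_swapn c n i j :
  `|\sum_(k < n) c k *: e (swapn i j k)| = `|\sum_(k < n) c k *: e k|.
Proof.
case: e_symmetric => _ /(_ n c (fun=> false) (swapn i j)) <-.
  by congr (`| _ |); apply: eq_bigr => k _; rewrite expr0 mul1r.
exact: inv_bij (swapnK i j).
Qed.

Lemma norm_basisE j : `|e j| = `|e 0%N|.
Proof. by have := norm_sum_swapn (fun=> 1) 1 0 j; rewrite !big_ord1 !scale1r. Qed.

(** Otherwise the coefficient of [e 0] in the expansion of 0 would be arbitrary, against
    uniqueness. *)
Lemma basis_neq0 : e 0%N != 0.
Proof.
apply/eqP => e0.
case: e_symmetric => /(_ 0)[a [_ aU]] _.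
have series0 c : (forall k, c k *: e k = 0) -> a = c.
  move=> ce0; apply: aU.
  rewrite (_ : series _ = fun=> 0); first exact: cvg_cst.
  by apply/funext => n; rewrite /series/= big1.
have : (fun=> 0 : R) = (fun k => (k == 0%N)%:R).
  rewrite -(series0 (fun=> 0)); last by move=> k; rewrite scale0r.
  by apply: series0 => -[|k]; rewrite ?e0 ?scaler0// scale0r.
by move/(congr1 (fun c => c 0%N))/eqP; rewrite eq_sym oner_eq0.
Qed.

Lemma norm_sum_increment_le f m (a b : 'I_m -> R) :
  (forall j, 0 <= a j /\ a j < b j /\ b j <= 1) ->
  trivIset [set: 'I_m] (fun j => `]a j, b j[%classic) ->
  `|\sum_(j < m) increment f (a j) (b j) *: e j| <=
  `|e 0%N| * \int[lebesgue_measure]_(x in `]0, 1[) `|f x|.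
Proof.
move=> ab tI; apply: (le_trans (ler_norm_sum _ _ _)).
under eq_bigr do rewrite normrZ norm_basisE mulrC.
by rewrite -mulr_sumr ler_wpM2l//; exact: sum_increment_le.
Qed.

Let JF_set f := [set y | exists m (a b : 'I_m -> R),
    [/\ forall j, 0 <= a j /\ a j < b j /\ b j <= 1,
        trivIset [set: 'I_m] (fun j => `]a j, b j[%classic) &
        y = `|\sum_(j < m) increment f (a j) (b j) *: e j|]].

Let JF_set0 f : JF_set f !=set0.
Proof.
exists 0, 0%N, (fun=> 0), (fun=> 0); split => [[]//|[]//|].
by rewrite big_ord0 normr0.
Qed.

(** Boundedness ensures that [sup] is a true upper bound and not a default value. *)
Let JF_set_ub f : has_ubound (JF_set f).
Proof.
exists (`|e 0%N| * \int[lebesgue_measure]_(x in `]0, 1[) `|f x|).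
by move=> _ [m [a [b [ab tI ->]]]]; exact: norm_sum_increment_le.
Qed.

Lemma JF_norm_le_L1 f :
  JF_norm e f <= `|e 0%N| * \int[lebesgue_measure]_(x in `]0, 1[) `|f x|.
Proof.
apply: ge_sup => [|_ [m [a [b [ab tI ->]]]]]; first exact: JF_set0.
exact: norm_sum_increment_le.
Qed.

Lemma JF_norm_le f (N : R) :
  (forall m a b, packing m a b ->
    `|\sum_(j < m) increment f (a j) (b j) *: e j| <= N) ->
  JF_norm e f <= N.
Proof.
move=> fN; apply: ge_sup => [|_ [m [a [b [ab tI ->]]]]]; first exact: JF_set0.
have := fN _ _ _ (trivIset_packing ab tI).
by under eq_bigr do rewrite !valK.
Qed.

Lemma JF_norm_ub f m a b : packing m a b ->
  `|\sum_(j < m) increment f (a j) (b j) *: e j| <= JF_norm e f.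
Proof.
(* Empty intervals are swapped to the end of the sum and dropped. *)
elim: m a b => [|m IH] a b pab.
  apply: (ub_le_sup (JF_set_ub f)).
  by exists 0%N, (a \o val), (b \o val); split => [[]//|[]//|].
have [ab|] := pselect (forall j : 'I_m.+1, a j < b j).
  apply: (ub_le_sup (JF_set_ub f)).
  exists m.+1, (a \o val), (b \o val); split => //=.
    by move=> j; have [] := pab.1 j (ltn_ord j).
  exact: packing_trivIset.
move=> /existsNP[j /negP]; rewrite -leNgt => ba.
have [aj0 abj bj1] := pab.1 j (ltn_ord j).
have abE : a j = b j by apply/le_anti; rewrite abj ba.
rewrite -(big_swapn (fun k => increment f (a k) (b k) *: e k) (ltn_ord j) (ltnSn m)).
rewrite (norm_sum_swapn (fun k => increment f (a (swapn j m k)) (b (swapn j m k)))).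
rewrite big_ord_recr/=.
have -> : swapn j m m = j.
  by rewrite /swapn eqxx; case: eqVneq.
rewrite abE incrementxx scale0r addr0.
apply: (IH (a \o swapn j m) (b \o swapn j m)).
by apply: packing_leq (leqnSn m) _; exact: packing_swapn.
Qed.

End JF.

(** * Comparison of norms by rounding endpoints *)

Section Compression.
Context (R : realType) (X : normedModType R) (e : nat -> X).
Hypothesis e_symmetric : one_symmetric_basis e.

(** Here [f] has the primitive [G], affine on [[p, q]], and [g] has the same increments between
    points outside []p, q[]. Increments of [f] are limits of averages of increments of [g] over
    rounded packings, and each rounded packing yields a sum of norm at most that of [g]. Finitely
    many thresholds and a limit replace a continuous average. *)
Lemma JF_norm_compress (f g : L1 R) (G : R -> R) (p q : R) :
  0 <= p -> p < q -> q <= 1 ->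
  (forall z, p <= z <= q -> (q - p) * (G z - G p) = (z - p) * (G q - G p)) ->
  (forall u v, 0 <= u -> u <= v -> v <= 1 -> increment f u v = G v - G u) ->
  (forall u v, 0 <= u -> u <= v -> v <= 1 ->
     u <= p \/ q <= u -> v <= p \/ q <= v -> increment g u v = G v - G u) ->
  JF_norm e f <= JF_norm e g.
Proof.
move=> p0 pq q1 affG fG gG; apply: JF_norm_le => // m a b pab.
pose S M s := step_round p q (s%:R / M.+1%:R).
pose avg (M : nat) x := M.+1%:R^-1 * \sum_(s < M.+1) G (S M s x).
have avgG x : (fun M => avg M x) @ \oo --> G x by exact: cvg_avg_step_round.
have cvgA : (fun M => `|\sum_(j < m) (avg M (b j) - avg M (a j)) *: e j|) @ \oo -->
    `|\sum_(j < m) (G (b j) - G (a j)) *: e j|.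
  apply: cvg_norm; apply: cvg_big => [|j _]; first exact: add_continuous.
  by apply: cvgZr_tmp; apply: cvgB.
rewrite (eq_bigr (fun j : 'I_m => (G (b j) - G (a j)) *: e j)); last first.
  by move=> j _; have [? ? ?] := pab.1 j (ltn_ord j); rewrite fG.
apply: (cvgr_to_le cvgA); apply: nearW => M.
have packS s : packing m (S M s \o a) (S M s \o b).
  apply: packing_homo pab; first exact: step_round_ndecr (ltW pq).
  exact: step_round_01.
(* Rounded endpoints avoid []p, q[], so the differences of [G] between them are increments of
   [g]. *)
have -> : \sum_(j < m) (avg M (b j) - avg M (a j)) *: e j = M.+1%:R^-1 *:
    \sum_(s < M.+1) \sum_(j < m) increment g (S M s (a j)) (S M s (b j)) *: e j.
  rewrite exchange_big scaler_sumr; apply: eq_bigr => j _.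
  rewrite -mulrBr -sumrB -scalerA scaler_suml; congr (_ *: _).
  apply: eq_bigr => s _; congr (_ *: _); apply/esym.
  have [a0 ab b1] := (packS s).1 j (ltn_ord j).
  by apply: gG => //; exact: step_round_notin.
rewrite normrZ ger0_norm ?invr_ge0// ler_pdivrMl//.
apply: (le_trans (ler_norm_sum _ _ _)).
rewrite mulr_natl -[X in _ *+ X]card_ord -sumr_const; apply: ler_sum => s _.
exact: (JF_norm_ub e_symmetric g (packS s)).
Qed.

End Compression.

(** * Primitives of Haar functions *)

Section HaarPrimitive.
Context (R : realType).
Local Notation mu := (@lebesgue_measure R).

(** For [p <= q], a primitive of the indicator of [[p, q]]: [p] plus the length of the part of
    [[p, q]] to the left of [x]. *)
Definition clamp (p q x : R) : R := Num.min (Num.max x p) q.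

Lemma Rintegral_indic_itv (c d : bool) (p q a b : R) : a <= b -> p <= q ->
  \int[mu]_(x in `]a, b[) \1_[set` Interval (BSide c p) (BSide d q)] x =
  clamp p q b - clamp p q a.
Proof.
move=> ab pq; rewrite /Rintegral integral_indic//.
pose l := Num.max a p; pose u := Num.min b q.
(* Whichever endpoints are included, the intersection lies between []l, u[] and [[l, u]], which have
   equal measure. *)
have Ilu : mu ([set` Interval (BSide c p) (BSide d q)] `&` `]a, b[%classic) =
  (Num.max 0 (u - l))%:E.
  apply/le_anti/andP; split.
    apply: (@le_trans _ _ (mu `[l, u]%classic)).
      apply: le_measure; rewrite ?inE//; first exact: measurableI.
      move=> x []; rewrite /= !in_itv/= => pxq /andP[ax xb].
      rewrite /l /u ge_max le_min !(ltW ax, ltW xb)/=.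
      by move: pxq; case: c; case: d => /= /andP[px xq]; rewrite ?(ltW px) ?(ltW xq) ?px ?xq.
    rewrite lebesgue_measure_itv/= lte_fin; case: ifP => lu.
      by rewrite -EFinB lee_fin le_max lexx orbT.
    by rewrite lee_fin le_max lexx.
  apply: (@le_trans _ _ (mu `]l, u[%classic)).
    rewrite lebesgue_measure_itv/= lte_fin; case: ltP => lu.
      by rewrite -EFinB lee_fin ge_max lexx subr_ge0 ltW.
    by rewrite lee_fin ge_max lexx subr_le0 lu.
  apply: le_measure; rewrite ?inE//; first exact: measurableI.
  move=> x; rewrite /= !in_itv/= /l /u gt_max lt_min => /andP[/andP[-> px] /andP[-> xq]].
  by split => //; case: c; case: d => /=; rewrite ?px ?xq ?(ltW px) ?(ltW xq).
transitivity (Num.max 0 (u - l)); first exact: (congr1 fine Ilu).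
rewrite /clamp /l /u.
case: (leP a p) => ?; case: (leP b p) => ?; case: (leP b q) => ?; case: leP => ?;
  do ?[case: leP => ?]; lra.
Qed.

Lemma clampD p c q x : p <= c -> c <= q ->
  clamp p c x + clamp c q x = clamp p q x + c.
Proof.
move=> pc cq; rewrite /clamp.
by have [?|?] := leP x p; have [?|?] := leP x c; have [?|?] := leP x q;
  do ?[case: leP => ?]; lra.
Qed.

Lemma le_dyadic k i j : (dyadic R k i <= dyadic R k j) = (i <= j)%N.
Proof. by rewrite /dyadic ler_pM2r ?invr_gt0 ?exprn_gt0// ler_nat. Qed.

Lemma lt_dyadic k i j : (dyadic R k i < dyadic R k j) = (i < j)%N.
Proof. by rewrite /dyadic ltr_pM2r ?invr_gt0 ?exprn_gt0// ltr_nat. Qed.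

Lemma dyadic_refine l k j : dyadic R k j = dyadic R (l + k) (2 ^ l * j).
Proof.
by rewrite /dyadic natrM natrX exprD invfM mulrACA divff ?mul1r// expf_neq0.
Qed.

Lemma dyadic_double k j : dyadic R k.+1 (2 * j) = dyadic R k j.
Proof. by rewrite [RHS](dyadic_refine 1). Qed.

Lemma dyadic_ge0 k j : 0 <= dyadic R k j.
Proof. by rewrite divr_ge0// exprn_ge0. Qed.

Lemma dyadic_top k : dyadic R k (2 ^ k) = 1.
Proof. by rewrite /dyadic natrX divff// expf_neq0. Qed.

Lemma dyadic_midpoint k j :
  dyadic R k j.+1 - dyadic R k j = dyadic R k j.+2 - dyadic R k j.+1.
Proof. by rewrite /dyadic -!mulrBl -!natr1; congr (_ / _); ring. Qed.

(* For [0 < n], the closed support of [haar_fun n] is the interval from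
   [haar_lo n] to [haar_hi n]; positions are counted from 0. *)
Definition haar_gen n := trunc_log 2 n.
Definition haar_pos n := (n - 2 ^ haar_gen n)%N.
Definition haar_lo n := dyadic R (haar_gen n) (haar_pos n).
Definition haar_hi n := dyadic R (haar_gen n) (haar_pos n).+1.

Lemma haar_pos_lt n : (0 < n)%N -> (haar_pos n < 2 ^ haar_gen n)%N.
Proof.
move=> n0; have /andP[n1 n2] := trunc_log_bounds (ltnSn 1) n0.
by move: n2; rewrite /haar_pos /haar_gen expnS; lia.
Qed.

Lemma haar_posE n : (0 < n)%N -> (n.+1 - 2 ^ haar_gen n)%N = (haar_pos n).+1.
Proof.
by move=> n0; rewrite /haar_pos subSn//; case/andP: (trunc_log_bounds (ltnSn 1) n0).
Qed.

Lemma haar_lo_ge0 n : 0 <= haar_lo n. Proof. exact: dyadic_ge0. Qed.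

Lemma haar_lo_lt_hi n : haar_lo n < haar_hi n. Proof. by rewrite lt_dyadic. Qed.

Lemma haar_hi_le1 n : (0 < n)%N -> haar_hi n <= 1.
Proof.
by move=> n0; rewrite -(dyadic_top (haar_gen n)) le_dyadic haar_pos_lt.
Qed.

(** A primitive of [haar_fun n] on [[0, 1]]; its additive constant cancels in increments. *)
Definition haar_prim n : R -> R :=
  if n is 0 then clamp 0 1 else
  let k := (haar_gen n).+1 in let j := (2 * haar_pos n)%N in
  fun x => clamp (dyadic R k j) (dyadic R k j.+1) x
         - clamp (dyadic R k j.+1) (dyadic R k j.+2) x.

(** [haar_wavelet] counts positions from 1 and [haar_pos] from 0, so [2 * i - 2] becomes
    [2 * haar_pos n]. *)
Lemma haar_fun_posE n : (0 < n)%N -> @haar_fun R n = fun x =>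
  let k := (haar_gen n).+1 in let j := (2 * haar_pos n)%N in
  \1_(`[dyadic R k j, dyadic R k j.+1]) x - \1_(`]dyadic R k j.+1, dyadic R k j.+2]) x.
Proof.
case: n => // n n0; rewrite /haar_fun -/(haar_gen _) haar_posE// /haar_wavelet.
by rewrite mulnS addKn.
Qed.

Lemma increment_haar n a b : 0 <= a -> a <= b -> b <= 1 ->
  increment (haar R n) a b = haar_prim n b - haar_prim n a.
Proof.
move=> a0 ab b1; rewrite /increment.
rewrite (_ : (haar R n : R -> R) = @haar_fun R n)//.
case: n => [|n]; first exact: Rintegral_indic_itv.
have fin c d p q : mu.-integrable `]a, b[
    (EFin \o \1_[set` Interval (BSide c p) (BSide d q)]).
  by apply: (@integrableS _ _ _ _ setT) => //; exact: integrable_indic_itv.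
rewrite haar_fun_posE// RintegralB//=.
rewrite !Rintegral_indic_itv//; last 2 first.
- by rewrite le_dyadic.
- by rewrite le_dyadic.
by ring.
Qed.

(** The halves of the support have equal length, so the rise over the first cancels the fall over
    the second. *)
Lemma haar_prim_out n x : (0 < n)%N -> x <= haar_lo n \/ haar_hi n <= x ->
  haar_prim n x = haar_lo n - dyadic R (haar_gen n).+1 (2 * haar_pos n).+1.
Proof.
case: n => // n _; rewrite /haar_prim /haar_lo /haar_hi.
move: (haar_gen _) (haar_pos _) => k j.
rewrite -!(dyadic_double k) mulnS.
have := dyadic_midpoint k.+1 (2 * j); rewrite add2n.
have : dyadic R k.+1 (2 * j) < dyadic R k.+1 (2 * j).+1 by rewrite lt_dyadic.
move: (dyadic _ _ _) (dyadic _ _ _) (dyadic _ _ _) => p c q pc cpq.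
rewrite /clamp => xpq.
have [xp|px] := leP x p; have [xc|cx] := leP x c; have [xq|qx] := leP x q;
 do ?[case: leP => ?]; lra.
Qed.

(** The equation of the chord, multiplied out to avoid division. *)
Definition affine_on (p q : R) (G : R -> R) :=
  forall z, p <= z <= q -> (q - p) * (G z - G p) = (z - p) * (G q - G p).

(** With both breakpoints outside []p, q[], [clamp c d] is the identity or a constant on
    [[p, q]]. *)
Lemma affine_clamp p q c d : p <= q -> c <= d ->
  c <= p \/ q <= c -> d <= p \/ q <= d -> affine_on p q (clamp c d).
Proof.
move=> pq cd pc pd z /andP[pz zq].
have [clE|clE] : (forall x, p <= x <= q -> clamp c d x = x) \/
    (exists r, forall x, p <= x <= q -> clamp c d x = r); last 2 first.
- by rewrite !clE ?lexx ?pz ?pq ?zq// mulrC.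
- by case: clE => r clE; rewrite !clE ?lexx ?pz ?pq ?zq// subrr !mulr0.
case: pd => [dp|qd].
  right; exists d => x /andP[px xq].
  by apply: min_r; rewrite le_max (le_trans dp px).
case: pc => [cp|qc].
  left=> x /andP[px xq]; rewrite /clamp max_l ?(le_trans cp px)//.
  by rewrite min_l// (le_trans xq qd).
right; exists c => x /andP[px xq].
by rewrite /clamp max_r ?(le_trans xq qc)// min_l.
Qed.

(** No breakpoint of an earlier primitive lies inside the support of a later Haar function. *)
Lemma haar_prim_affine k n : (k < n)%N ->
  affine_on (haar_lo n) (haar_hi n) (haar_prim k).
Proof.
move=> kn; have n0 : (0 < n)%N by exact: leq_ltn_trans kn.
have pq := ltW (haar_lo_lt_hi n).
case: k kn => [|k] kn.
  apply: affine_clamp => //; [left; exact: haar_lo_ge0|right; exact: haar_hi_le1].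
have gap t : (t <= (2 * haar_pos k.+1).+2)%N ->
    dyadic R (haar_gen k.+1).+1 t <= haar_lo n \/
    haar_hi n <= dyadic R (haar_gen k.+1).+1 t.
  move=> tk; have : (haar_gen k.+1 <= haar_gen n)%N by apply: leq_trunc_log; exact: ltnW.
  rewrite leq_eqVlt => /predU1P[kE|klt].
    (* Within a generation, the earlier support lies to the left of the later one. *)
    left; rewrite /haar_lo kE -(dyadic_double (haar_gen n)) le_dyadic (leq_trans tk)//.
    rewrite /haar_pos kE.
    have /andP[n1 n2] := trunc_log_bounds (ltnSn 1) n0.
    have /andP[k1 k2] := trunc_log_bounds (ltnSn 1) (ltn0Sn k).
    rewrite -/(haar_gen _) kE in k1; lia.
  (* A breakpoint from an earlier generation is a multiple of the length of the support, whose
     endpoints are consecutive multiples. *)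
  rewrite /haar_lo /haar_hi (dyadic_refine (haar_gen n - (haar_gen k.+1).+1)) subnK// !le_dyadic.
  by case: leqP; [left|right].
have aff1 t : (t < (2 * haar_pos k.+1).+2)%N -> affine_on (haar_lo n) (haar_hi n)
    (clamp (dyadic R (haar_gen k.+1).+1 t) (dyadic R (haar_gen k.+1).+1 t.+1)).
  by move=> tk; apply: affine_clamp => //; rewrite ?le_dyadic//; apply: gap => //; exact: ltnW.
move=> z zpq; rewrite /haar_prim.
have H1 := aff1 _ (leqnSn _) z zpq; have H2 := aff1 _ (leqnn _) z zpq.
lra.
Qed.

End HaarPrimitive.

(** * Approximation by dyadic steps *)

Section ClosedSpan.
Context (R : realType) (Y : normedModType R) (y : nat -> Y).

Definition in_closed_span (x : Y) : Prop := forall r : R, 0 < r ->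
  exists (c : nat -> R) n, `|x - \sum_(k < n) c k *: y k| < r.

Lemma sum_truncate (c : nat -> R) m n : (m <= n)%N ->
  \sum_(k < n) (if (k < m)%N then c k else 0) *: y k = \sum_(k < m) c k *: y k.
Proof.
move=> mn; rewrite (big_ord_widen n (fun k => c k *: y k) mn) [RHS]big_mkcond/=.
by apply: eq_bigr => k _; case: ifP => // _; rewrite scale0r.
Qed.

Lemma in_closed_span_gen k : in_closed_span (y k).
Proof.
move=> r r0; exists (fun i => (i == k)%:R), k.+1.
rewrite big_ord_recr/= eqxx scale1r big1 ?add0r ?subrr ?normr0// => i _.
by rewrite ltn_eqF// scale0r.
Qed.

Lemma in_closed_spanZ a x : in_closed_span x -> in_closed_span (a *: x).
Proof.
move=> xs r r0.
(* Adding 1 keeps the divisor positive when [a] is 0. *)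
have a1 : 0 < `|a| + 1 by rewrite ltr_wpDl.
have [c [n cn]] := xs (r / (`|a| + 1)) (divr_gt0 r0 a1).
exists (fun k => a * c k), n.
rewrite (eq_bigr (fun k : 'I_n => a *: (c k *: y k))); last first.
  by move=> k _; rewrite scalerA.
rewrite -scaler_sumr -scalerBr normrZ.
move: cn; rewrite ltr_pdivlMr// mulrC; apply: le_lt_trans.
by rewrite ler_wpM2r// lerDl.
Qed.

Lemma in_closed_spanD x x' :
  in_closed_span x -> in_closed_span x' -> in_closed_span (x + x').
Proof.
move=> xs xs' r r0; have r2 : 0 < r / 2 by rewrite divr_gt0.
have [c [n cn]] := xs _ r2; have [c' [n' cn']] := xs' _ r2.
exists (fun k => (if (k < n)%N then c k else 0) + (if (k < n')%N then c' k else 0)),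
  (maxn n n').
under eq_bigr do rewrite scalerDl.
rewrite big_split/= !sum_truncate ?leq_maxl ?leq_maxr// opprD addrACA.
by rewrite (splitr r) (le_lt_trans (ler_normD _ _))// ltrD.
Qed.

Lemma in_closed_span_sum m (x : 'I_m -> Y) :
  (forall i, in_closed_span (x i)) -> in_closed_span (\sum_i x i).
Proof.
move=> xs; elim/big_ind : _ => [r r0||i _]; last exact: xs.
  by exists (fun=> 0), 0%N; rewrite big_ord0 subrr normr0.
exact: in_closed_spanD.
Qed.

Lemma in_closed_span_lim x : (forall r : R, 0 < r ->
  exists2 x', in_closed_span x' & `|x - x'| < r) -> in_closed_span x.
Proof.
move=> xl r r0; have r2 : 0 < r / 2 by rewrite divr_gt0.
have [x' xs' xx'] := xl _ r2; have [c [n cn]] := xs' _ r2.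
exists c, n; rewrite -(subrKA x') (splitr r).
by rewrite (le_lt_trans (ler_normD _ _))// ltrD.
Qed.

End ClosedSpan.

(** * Sampling functions on dyadic intervals *)

Section StepApproximation.
Context (R : realType).
Local Notation mu := (@lebesgue_measure R).

Lemma indic_L1 (i : interval R) :
  (\1_[set` i] : measurableTypeR R -> R) \in Lfun (lebesgue01 R) 1%E.
Proof.
apply/Lfun1_integrable; apply: (@integrable_indic _ _ _ (lebesgue01 R)).
exact: measurable_itv.
Qed.

(** Half-open intervals of one generation partition [[0, 1[], which makes [dyadic_step] a pointwise
    sampling. *)
Definition dyadic_indic k j : L1 R :=
  Lfun_Sub (lexx 1%E) (indic_L1 `[dyadic R k j, dyadic R k j.+1[).

Lemma dyadic_indicE k j (x : R) :
  dyadic_indic k j x = (dyadic R k j <= x < dyadic R k j.+1)%R%:R.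
Proof.
rewrite -[LHS]/(\1_[set` `[dyadic R k j, dyadic R k j.+1[] x) indicE.
by rewrite mem_setE in_itv.
Qed.

Lemma increment_dyadic_indic k j a b : a <= b ->
  increment (dyadic_indic k j) a b =
  clamp (dyadic R k j) (dyadic R k j.+1) b - clamp (dyadic R k j) (dyadic R k j.+1) a.
Proof. by move=> ab; rewrite /increment Rintegral_indic_itv// le_dyadic. Qed.

Lemma L1_sumE n (c : 'I_n -> R) (h : 'I_n -> L1 R) (x : R) :
  (\sum_(i < n) c i *: h i) x = \sum_(i < n) c i * h i x.
Proof.
pose ev (f : L1 R) := f x.
have ev0 : ev 0 = 0 by [].
have evD : {morph ev : f g / f + g} by [].
have evZ a f : ev (a *: f) = a * ev f by [].
rewrite -/(ev _) (big_morph ev evD ev0).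
by apply: eq_bigr => i _; rewrite evZ.
Qed.

Definition dyadic_step k (g : R -> R) : L1 R :=
  \sum_(j < 2 ^ k) g (dyadic R k j) *: dyadic_indic k j.

Lemma dyadic_stepE k g x : 0 <= x < 1 ->
  exists2 j, dyadic_step k g x = g (dyadic R k j) &
             dyadic R k j <= x < dyadic R k j.+1.
Proof.
move=> /andP[x0 x1]; have k0 : 0 < 2 ^+ k :> R by rewrite exprn_gt0.
pose j := Num.truncn (x * 2 ^+ k).
have /andP[jx xj] : dyadic R k j <= x < dyadic R k j.+1.
  by rewrite ler_pdivrMr// ltr_pdivlMr// truncn_itv// mulr_ge0// ltW.
have jk : (j < 2 ^ k)%N.
  by rewrite -(lt_dyadic R k) dyadic_top (le_lt_trans jx).
exists j; last exact/andP.
rewrite /dyadic_step L1_sumE.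
under eq_bigr do rewrite dyadic_indicE.
rewrite (bigD1 (Ordinal jk))//= big1 ?addr0 => [|i ij].
  by rewrite jx xj mulr1.
case: andP => [[ix xi]|_]; last by rewrite mulr0.
move/negP: ij; case; rewrite -val_eqE/= eqn_leq; apply/andP; split.
  by rewrite -ltnS -(lt_dyadic R k) (le_lt_trans ix).
by rewrite -ltnS -(lt_dyadic R k) (le_lt_trans jx).
Qed.

(** Heine-Cantor, with only [x] confined to [[0, 1]]; compactness is used as a covering property
    with [d] tending to 0 from the right. *)
Lemma uniform_on01 (g : R -> R) (r : R) : continuous g -> 0 < r ->
  exists d : R, 0 < d /\ forall x z, 0 <= x <= 1 -> `|x - z| < d -> `|g x - g z| < r.
Proof.
move=> gc r0; have r2 : 0 < r / 2 by rewrite divr_gt0.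
have cpt := @segment_compact R 0 1.
have := (compact_near_coveringP _).1 cpt R (0^'+)
  (fun d x => forall z, `|x - z| < d -> `|g x - g z| < r).
case.
  move=> x _.
  have /cvgrPdist_lt/(_ _ r2) := gc x.
  case/nbhs_ballP => d /= d0 dg.
  have d2 : 0 < d / 2 by rewrite divr_gt0.
  (* Half the radius covers the move from [x] to [x'], half that from [x'] to [z]. *)
  exists (ball x (d / 2), [set d' | d' < d / 2]) => /=.
    split; first exact: nbhsx_ballx.
    exact: nbhs_right_lt.
  move=> [x' d'] /= [xx' d'd] z xz.
  rewrite -(subrKA (g x)) (splitr r) (le_lt_trans (ler_normD _ _))// ltrD//.
    rewrite distrC; apply: dg; apply: le_ball xx'; lra.
  apply: dg; rewrite -ball_normE/= -(subrKA x') (splitr d).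
  rewrite (le_lt_trans (ler_normD _ _))// ltrD//.
  exact: lt_trans d'd.
move=> d /= d0 dg.
exists (d / 2); split; first by rewrite divr_gt0.
move=> x z x01; apply: (dg (d / 2)).
- by rewrite /= sub0r normrN ger0_norm; lra.
- by rewrite divr_gt0.
- by rewrite /= in_itv.
Qed.

End StepApproximation.

(** * The Haar basis *)

Section HaarBasis.
Context (R : realType) (X : completeNormedModType R) (e : nat -> X).
Hypothesis e_symmetric : one_symmetric_basis e.
Context (JF : completeNormedModType R) (iota : {linear L1 R -> JF}).
Hypothesis JF_completion : is_completion (JF_norm e) iota.
Local Notation mu := (@lebesgue_measure R).
Local Notation haar_iota := (fun n => iota (haar R n)).

Let norm_iota f : `|iota f| = JF_norm e f. Proof. by case: JF_completion. Qed.

(** The norm sees a function only through its increments, so values at single points are irrelevant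
    in the completion. *)
Lemma eq_iota f g :
  (forall a b, 0 <= a -> a <= b -> b <= 1 -> increment f a b = increment g a b) ->
  iota f = iota g.
Proof.
move=> fg; apply/eqP; rewrite -subr_eq0 -normr_le0 -raddfB norm_iota.
apply: JF_norm_le => // m a b [ab _]; rewrite big1 ?normr0// => j _.
have [a0 abj b1] := ab j (ltn_ord j).
by rewrite -scaleN1r incrementD// incrementZ// fg// mulN1r subrr scale0r.
Qed.

(** Induction on the generation: the two halves of a dyadic interval have as indicators half the sum
    and half the difference of the indicator of the whole and the Haar function supported there, up
    to endpoints. *)
Lemma dyadic_indic_in_span k j : (j < 2 ^ k)%N ->
  in_closed_span haar_iota (iota (dyadic_indic R k j)).
Proof.
elim: k j => [|k IH] j jk.
  have -> : iota (dyadic_indic R 0 j) = haar_iota 0%N; last exact: in_closed_span_gen.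
  apply: eq_iota => a b a0 ab b1; rewrite increment_dyadic_indic// increment_haar//.
  by move: jk; rewrite expn0 ltnS leqn0 => /eqP ->; rewrite /dyadic !expr0 !divr1.
pose i := j./2; have ik : (i < 2 ^ k)%N.
  by rewrite /i ltn_half_double -mul2n -expnS.
have [n0 genE posE] : [/\ 0 < 2 ^ k + i, haar_gen (2 ^ k + i) = k &
    haar_pos (2 ^ k + i) = i]%N.
  have genE : haar_gen (2 ^ k + i) = k.
    by rewrite /haar_gen; apply: trunc_log_eq => //;
      rewrite leq_addr/= expnS mul2n -addnn ltn_add2l.
  by rewrite addn_gt0 expn_gt0 /haar_pos genE addKn.
have incE a b : 0 <= a -> a <= b -> b <= 1 ->
  increment (dyadic_indic R k i) a b =
    increment (dyadic_indic R k.+1 (2 * i)) a b + increment (dyadic_indic R k.+1 (2 * i).+1) a b /\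
  increment (haar R (2 ^ k + i)) a b =
    increment (dyadic_indic R k.+1 (2 * i)) a b - increment (dyadic_indic R k.+1 (2 * i).+1) a b.
  move=> a0 ab b1; rewrite !increment_dyadic_indic// increment_haar//.
  have -> : @haar_prim R (2 ^ k + i) = fun x =>
     clamp (dyadic R k.+1 (2 * i)) (dyadic R k.+1 (2 * i).+1) x
     - clamp (dyadic R k.+1 (2 * i).+1) (dyadic R k.+1 (2 * i).+2) x.
    by case: (2 ^ k + i)%N n0 genE posE => // n _ genE posE; rewrite /haar_prim genE posE.
  split; last by ring.
  rewrite -!(dyadic_double R k) mulnS add2n.
  have le1 j' : dyadic R k.+1 j' <= dyadic R k.+1 j'.+1 by rewrite le_dyadic.
  have := clampD a (le1 (2 * i)%N) (le1 (2 * i).+1).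
  have := clampD b (le1 (2 * i)%N) (le1 (2 * i).+1).
  lra.
have h1 := IH i ik; have h2 := in_closed_span_gen haar_iota (2 ^ k + i).
have jE : j = (2 * i)%N \/ j = (2 * i).+1.
  by rewrite /i mul2n -[j in j = _ \/ j = _]odd_double_half; case: (odd j); [right|left].
case: jE => ->.
  have -> : iota (dyadic_indic R k.+1 (2 * i)) =
      2^-1 *: iota (dyadic_indic R k i) + 2^-1 *: iota (haar R (2 ^ k + i)).
    rewrite -!linearZ -raddfD; apply: eq_iota => a b a0 ab b1.
    by rewrite incrementD// !incrementZ//; have [-> ->] := incE a b a0 ab b1; field.
  by apply: in_closed_spanD; exact: in_closed_spanZ.
have -> : iota (dyadic_indic R k.+1 (2 * i).+1) =
    2^-1 *: iota (dyadic_indic R k i) + (- 2^-1) *: iota (haar R (2 ^ k + i)).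
  rewrite -!linearZ -raddfD; apply: eq_iota => a b a0 ab b1.
  by rewrite incrementD// !incrementZ//; have [-> ->] := incE a b a0 ab b1; field.
by apply: in_closed_spanD; exact: in_closed_spanZ.
Qed.

Lemma L1_in_span f : in_closed_span haar_iota (iota f).
Proof.
apply: in_closed_span_lim => r r0.
have C0 : 0 < `|e 0%N| by rewrite normr_gt0 (basis_neq0 e_symmetric).
(* Two errors of size [d] will occur, in the L1 distance from [f] to [g] and in the uniform distance
   from [g] to its step function; a third keeps the total strictly below [r]. *)
pose d := r / `|e 0%N| / 3.
have d0 : 0 < d by rewrite !divr_gt0.
have f01 : mu.-integrable `]0, 1[ (EFin \o f) by exact: integrable_L1.
have mu01 : mu (`]0, 1[%classic : set R) = 1%E.
  by rewrite lebesgue_measure_itv/= lte_fin ltr01 oppr0 adde0.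
have [g [gc gi fg]] : exists g : R -> R, [/\ continuous g, mu.-integrable `]0, 1[ (EFin \o g) &
    \int[mu]_(x in `]0, 1[) `|f x - g x| < d].
  have [||//|g_ [g_c g_i]] := @approximation_continuous_integrable R `]0, 1[ f.
  - exact: measurable_itv.
  - by rewrite [X in (X < _)%E]mu01 ltry.
  move=> /fine_cvgP[_ /cvgrPdist_lt /(_ _ d0)[N _ /(_ N (leqnn N))]].
  rewrite /= sub0r normrN => fgN.
  exists (g_ N); split => //; exact: le_lt_trans (ler_norm _) fgN.
have [w [w0 gw]] := uniform_on01 gc d0.
have [k _ /(_ k (leqnn k)) /= kw] := near_infty_natSinv_expn_lt (PosNum w0).
exists (iota (dyadic_step k g)).
  rewrite /dyadic_step linear_sum; apply: in_closed_span_sum => j.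
  by rewrite linearZ; apply: in_closed_spanZ; exact: dyadic_indic_in_span.
rewrite -raddfB norm_iota (le_lt_trans (JF_norm_le_L1 e_symmetric _))//.
set s := dyadic_step k g.
have s01 : mu.-integrable `]0, 1[ (EFin \o s) by exact: integrable_L1.
have fs01 : mu.-integrable `]0, 1[ (EFin \o (f - s)) by exact: integrable_L1.
have fgi : mu.-integrable `]0, 1[ (EFin \o (fun x => `|f x - g x|)).
  apply: (@integrable_norm _ _ _ _ _ (fun x => f x - g x)).
  by apply: (integrableB _ f01 gi).
have di : mu.-integrable `]0, 1[ (EFin \o (fun=> d)).
  have : mu.-integrable `[0, 1] (EFin \o (fun=> d)).
    apply: continuous_compact_integrable; first exact: segment_compact.
    by apply: continuous_subspaceT => x; exact: cvg_cst.
  by apply: integrableS => //; exact: subset_itv_oo_cc.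
have : \int[mu]_(x in `]0, 1[) `|(f - s) x| <=
       \int[mu]_(x in `]0, 1[) (`|f x - g x| + d).
  apply: le_Rintegral => //.
  - exact: integrable_norm.
  - by apply: (integrableD _ fgi di).
  move=> x /=; rewrite in_itv/= => /andP[x0 x1].
  have x01 : 0 <= x < 1 by rewrite ltW.
  have [j sx /andP[jx xj]] := dyadic_stepE k g x01.
  change (`|f x - s x| <= `|f x - g x| + d).
  rewrite [s x]sx -(subrKA (g x)) (le_trans (ler_normD _ _))// lerD2l ltW//.
  apply: gw; first by rewrite !ltW.
  rewrite ger0_norm ?subr_ge0//; apply: lt_trans kw.
  rewrite ltrBlDl (lt_le_trans xj)// /dyadic -natr1 mulrDl lerD2l//.
rewrite RintegralD// Rintegral_cst//.
rewrite [X in fine X]mu01 mulr1.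
move=> H; rewrite mulrC -ltr_pdivlMr//.
by apply: (le_lt_trans H); rewrite -/d; move: d0 fg; rewrite /d; lra.
Qed.

(** A single interval suffices: [[0, 1]] for the first function, the left half of the support for
    the others. *)
Lemma haar_iota_neq0 n : iota (haar R n) != 0.
Proof.
have [a [b [a0 ab b1 hab]]] : exists a b, [/\ 0 <= a, a <= b, b <= 1 &
    @haar_prim R n b - @haar_prim R n a != 0].
  case: n => [|n].
    exists 0, 1; split => //.
    by rewrite /haar_prim /clamp !maxxx max_l// min_r// min_l// subr0 oner_eq0.
  pose p := haar_lo R n.+1; pose c := dyadic R (haar_gen n.+1).+1 (2 * haar_pos n.+1).+1.
  have pE : p = dyadic R (haar_gen n.+1).+1 (2 * haar_pos n.+1).
    by rewrite dyadic_double.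
  have qE : haar_hi R n.+1 = dyadic R (haar_gen n.+1).+1 (2 * haar_pos n.+1).+2.
    by rewrite -add2n -mulnS dyadic_double.
  have pc : p < c by rewrite pE lt_dyadic.
  have cq : c < haar_hi R n.+1 by rewrite qE lt_dyadic.
  exists p, c; split; [exact: haar_lo_ge0|exact: ltW| |].
    exact: le_trans (ltW cq) (haar_hi_le1 R (ltn0Sn n)).
  rewrite [X in _ - X]haar_prim_out//; last by left.
  rewrite /haar_prim -pE -qE -/c /clamp maxxx (max_l (ltW pc)) minxx (min_l (ltW cq)).
  by rewrite subrr sub0r opprB gt_eqF// subr_gt0.
have pab : packing 1 (fun=> a) (fun=> b) by split => // -[|i] [|j].
have := JF_norm_ub e_symmetric (haar R n) pab.
rewrite big_ord1 increment_haar// normrZ -norm_iota -normr_gt0; apply: lt_le_trans.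
by rewrite mulr_gt0// normr_gt0// (basis_neq0 e_symmetric).
Qed.

Lemma haar_iota_monotone (c : nat -> R) n :
  `|\sum_(k < n) c k *: iota (haar R k)| <= `|\sum_(k < n.+1) c k *: iota (haar R k)|.
Proof.
(* The first Haar function has nonzero mean and escapes compression, but there the shorter sum is
   empty. *)
case: n => [|n]; first by rewrite big_ord0 normr0.
have iotaE m : \sum_(k < m) c k *: iota (haar R k) = iota (\sum_(k < m) c k *: haar R k).
  by rewrite linear_sum; apply: eq_bigr => k _; rewrite linearZ.
rewrite !iotaE !norm_iota.
pose G x := \sum_(k < n.+1) c k * @haar_prim R k x.
have GB u v : G v - G u = \sum_(k < n.+1) c k * (@haar_prim R k v - @haar_prim R k u).
  by rewrite -sumrB; apply: eq_bigr => k _; rewrite mulrBr.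
have incG u v : 0 <= u -> u <= v -> v <= 1 ->
    increment (\sum_(k < n.+1) c k *: haar R k) u v = G v - G u.
  move=> u0 uv v1; rewrite increment_sum// GB.
  by apply: eq_bigr => k _; rewrite increment_haar.
apply: (JF_norm_compress e_symmetric (haar_lo_ge0 R n.+1) (haar_lo_lt_hi R n.+1)
  (haar_hi_le1 R (ltn0Sn n)) _ incG).
  move=> z zpq; rewrite !GB !mulr_sumr; apply: eq_bigr => k _.
  by rewrite mulrCA (haar_prim_affine (ltn_ord k) zpq) mulrCA.
(* Between points outside its support the last Haar function has increment 0, so both sums have the
   same increment. *)
move=> u v u0 uv v1 uo vo.
rewrite big_ord_recr/= incrementD// incG// incrementZ// increment_haar//.
by rewrite !(haar_prim_out (ltn0Sn n))// subrr mulr0 addr0.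
Qed.

Lemma haar_iota_total (x : JF) : in_closed_span haar_iota x.
Proof.
apply: in_closed_span_lim => r r0.
have [_ dense_iota] := JF_completion.
have [z [xr [f _ fz]]] := dense_iota (ball x r) (ex_intro _ x (ballxx x r0)) (ball_open x r).
exists (iota f); first exact: L1_in_span.
by move: xr; rewrite -ball_normE/= -fz.
Qed.

End HaarBasis.

Theorem corollary2p4 (R : realType) (X : completeNormedModType R)
    (e : nat -> X)
    (X_reflexive : reflexive_space X)
    (e_symmetric : one_symmetric_basis e)
    (JF : completeNormedModType R) (iota : {linear L1 R -> JF})
    (JF_completion : is_completion (JF_norm e) iota) :
  schauder_basis (fun n => iota (haar R n)).
Proof.
apply: schauder_basis_monotone.
- exact (haar_iota_neq0 e_symmetric JF_completion).
- exact (haar_iota_monotone e_symmetric JF_completion).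
- exact (haar_iota_total e_symmetric JF_completion).
Qed.
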